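(* Let $m,n$ be positive integers, let $\mathcal{A}\subseteq \mathbb{Z}/m\mathbb{Z}$ and $\mathcal{B}\subseteq\mathbb{Z}/n\mathbb{Z}$ be collections of residue classes modulo $m$ and $n$, respectively, and let $g=\gcd(m,n)$. Let $h$ denote the number of solutions modulo $mn/g$ of the linear system \[ x\equiv a \pmod m,\qquad x\equiv b\pmod n \] as $(a,b)$ ranges over $\mathcal{A}\times\mathcal{B}$, i.e. $h$ is the number of residue classes $x$ modulo $mn/g$ such that $x \bmod m\in\mathcal{A}$ and $x\bmod n\in\mathcal{B}$. Write \[ |\mathcal{A}|=A\frac{m}{g}+r_A,\quad 0\le r_A<\frac{m}{g},\qquad |\mathcal{B}|=B\frac{n}{g}+r_B,\quad 0\le r_B<\frac{n}{g}, \] with $A,B$ non-negative integers. Then \[ h\ge\begin{cases}0,&\text{if } A+B<g-1,\\ r_Ar_B,&\text{if } A+B=g-1,\\ (A+B-g)\dfrac{mn}{g^2}+r_A\dfrac{n}{g}+r_B\dfrac{m}{g},&\text{if } A+B>g-1.\end{cases} \]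
   Context: Here $\mathcal{A}$ and $\mathcal{B}$ are arbitrary sets of residue classes (not necessarily intervals), and $A,B$ denote the integer quotients defined in the claim (distinct from the sets $\mathcal{A},\mathcal{B}$). *)

(* Defs.v *)
From mathcomp Require Import all_boot.

Set Implicit Arguments.
Unset Strict Implicit.
Unset Printing Implicit Defensive.

(* For m > 0, the residue classes modulo m are encoded by their least         *)
(* nonnegative representatives, i.e. by the elements of 'I_m ('Z_m would be   *)
(* wrong for m = 1).                                                          *)

Definition crt_solutions (m n : nat) (SA : {set 'I_m}) (SB : {set 'I_n}) :
    {set 'I_((m * n) %/ gcdn m n)} :=
  [set x : 'I_((m * n) %/ gcdn m n) |
    [exists a in SA, exists b in SB,
      (x == a %[mod m]) && (x == b %[mod n])]].

(* In the last branch g <= A + B, so the subtraction is not truncated; g - 1  *)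
(* is not truncated as long as g > 0.                                         *)
Definition crt_bound (m n A rA B rB : nat) : nat :=
  let g := gcdn m n in
  if A + B < g - 1 then 0
  else if A + B == g - 1 then rA * rB
  else (A + B - g) * ((m * n) %/ g ^ 2) + rA * (n %/ g) + rB * (m %/ g).

(* Main.v *)
Require Import Defs.
From mathcomp Require Import all_boot.
From mathcomp Require Import zify.

(** Put g = gcd(m,n), and let a_c and b_c count the elements of the two sets
    lying over the residue c modulo g.  By the Chinese remainder theorem
    h = \sum_c a_c b_c, where 0 <= a_c <= M = m/g and 0 <= b_c <= N = n/g.
    Summing (M - a_c)(N - b_c) >= 0 over c gives the bound for A + B >= g.
    If A + B = g - 1, the sum is smallest when the mass of a sits on the A
    smallest values of b: with T the set of these A indices and t the next
    smallest value of b, one gets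
      h >= M \sum_(c in T) b_c + rA t >= rA (\sum_(c in T) b_c + t) >= rA rB,
    since the g - 1 - A = B remaining values of b sum to at most B N. *)

(** Bezout gives [km * m = kn * n + gcdn m n]; scaling it by the quotient [q] of the gap between the
    targets moves [a] onto the class of [b] modulo [n]. *)
Lemma chinese_exists (m n a b : nat) :
  0 < m -> 0 < n -> a = b %[mod gcdn m n] ->
  exists x, x = a %[mod m] /\ x = b %[mod n].
Proof.
move=> m0 n0 eq_ab.
(* [b + a * n] lies in the class of [b] modulo [n] and is at least [a], so subtracting [a] is
   exact. *)
have le_a : a <= b + a * n by rewrite (leq_trans _ (leq_addl _ _)) ?leq_pmulr.
have /dvdnP[q def_q] : gcdn m n %| b + a * n - a.
  rewrite -eqn_mod_dvd // eq_ab -modnDmr.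
  by rewrite (eqnP (dvdn_mull a (dvdn_gcdr m n))) addn0.
case: (egcdnP n m0) => km kn def_g _.
exists (a + km * q * m); split; first by rewrite addnC modnMDl.
suff -> : a + km * q * m = (a + kn * q) * n + b by rewrite modnMDl.
by rewrite mulnAC def_g mulnDl (mulnC (gcdn m n)) -def_q; lia.
Qed.

Lemma card_fiber_product (T1 T2 I : finType) (f1 : T1 -> I) (f2 : T2 -> I)
    (X : {set T1}) (Y : {set T2}) :
  #|[set p in setX X Y | f1 p.1 == f2 p.2]| =
  \sum_i #|[set x in X | f1 x == i]| * #|[set y in Y | f2 y == i]|.
Proof.
rewrite -sum1_card (partition_big (fun p => f1 p.1) xpredT) //=.
apply: eq_bigr => i _; rewrite -cardsX -sum1_card; apply: eq_bigl => -[x y].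
rewrite !inE /=; case: (f1 x =P i) => [->|]; rewrite ?andbF ?andbT //.
by rewrite eq_sym andbA.
Qed.

Lemma card_partition_fibers (T I : finType) (f : T -> I) (X : {set T}) :
  #|X| = \sum_i #|[set x in X | f x == i]|.
Proof.
rewrite -sum1_card (partition_big f xpredT) //=.
by apply: eq_bigr => i _; rewrite -sum1_card; apply: eq_bigl => x; rewrite inE.
Qed.

(** On a fixed class modulo [g], the quotient [x %/ g] determines [x]. *)
Lemma card_mod_class_le (m g : nat) (X : {set 'I_m}) (c : nat) :
  0 < g -> g %| m -> #|[set x in X | x %% g == c]| <= m %/ g.
Proof.
move=> g0 gm.
have lt_div (x : 'I_m) : x %/ g < m %/ g by rewrite ltn_divLR // divnK.
rewrite -[leqRHS]card_ord.
rewrite -(@card_in_imset _ _ (fun x => Ordinal (lt_div x))) ?max_card //.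
move=> x y; rewrite !inE => /andP[_ /eqP xc] /andP[_ /eqP yc] [eq_div].
by apply: val_inj; rewrite /= (divn_eq x g) (divn_eq y g) xc yc eq_div.
Qed.

(** Expands [(M - a i) * (N - b i) >= 0], with the negative terms moved across to avoid truncated
    subtraction. *)
Lemma sum_mul_bounded (I : finType) (a b : I -> nat) (M N : nat) :
  (forall i, a i <= M) -> (forall i, b i <= N) ->
  N * (\sum_i a i) + M * (\sum_i b i) <= \sum_i a i * b i + #|I| * (M * N).
Proof.
move=> aM bN; rewrite -sum_nat_const !big_distrr -!big_split /=.
by apply: leq_sum => i _; have := aM i; have := bN i; nia.
Qed.

Lemma exists_min_outside (I : finType) (b : I -> nat) (T : {set I}) :
  #|T| < #|I| -> exists2 i, i \in ~: T & {in ~: T, forall j, b i <= b j}.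
Proof.
move=> ltT; have /card_gt0P[i0 i0T] : 0 < #|~: T|.
  by rewrite cardsCs setCK subn_gt0.
by case: (arg_minnP b i0T) => i; exists i.
Qed.

(** Greedy construction: a minimiser of [b] on the complement is adjoined at each stage. *)
Lemma exists_smallest_subset (I : finType) (b : I -> nat) (k : nat) :
  k <= #|I| ->
  exists2 T : {set I}, #|T| = k & {in T & ~: T, forall i j, b i <= b j}.
Proof.
elim: k => [|k IHk] le_k.
  by exists set0; [rewrite cards0 | move=> i j; rewrite inE].
have [T cardT minT] := IHk (ltnW le_k).
have [|i iT min_i] := exists_min_outside _ b T; first by rewrite cardT.
exists (i |: T); first by rewrite cardsU1 cardT; move: iT; rewrite inE => ->.
move=> j l; rewrite !inE negb_or => /orP[/eqP->|jT] /andP[_ lT].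
  by apply: min_i; rewrite inE.
by apply: minT; rewrite ?inE.
Qed.

Lemma sum_mul_critical (I : finType) (a b : I -> nat) (M N A rA B rB : nat) :
  (forall i, a i <= M) -> (forall i, b i <= N) -> rA <= M ->
  \sum_i a i = A * M + rA -> \sum_i b i = B * N + rB -> A + B + 1 = #|I| ->
  rA * rB <= \sum_i a i * b i.
Proof.
move=> aM bN rAM sum_a sum_b card_I.
have ltA : A < #|I| by lia.
have [T cardT minT] := exists_smallest_subset _ b _ (ltnW ltA).
have [|i iT min_i] := exists_min_outside _ b T; first by rewrite cardT.
set sT := \sum_(j in T) b j.
have split_T F : \sum_j F j = \sum_(j in T) F j + \sum_(j in ~: T) F j :> nat.
  by rewrite (bigID (mem T)) /=; congr (_ + _); apply: eq_bigl => j; rewrite inE.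
(* Termwise, this is [(M - a j) * (b i - b j) >= 0] for [j] in [T]. *)
have lb_T : M * sT + (\sum_(j in T) a j) * b i <=
            \sum_(j in T) a j * b j + A * (M * b i).
  rewrite -cardT -sum_nat_const /sT big_distrr big_distrl -!big_split /=.
  apply: leq_sum => j jT.
  by have := aM j; have := minT _ _ jT iT; nia.
have lb_TC : (\sum_(j in ~: T) a j) * b i <= \sum_(j in ~: T) a j * b j.
  by rewrite big_distrl leq_sum // => j jT; rewrite leq_mul2l min_i ?orbT.
have rB_le : rB <= sT + b i.
  have : \sum_(j in ~: T) b j <= b i + B * N.
    rewrite (bigD1 i) //= leq_add2l.
    have -> : B = #|~: T :\ i|.
      by have := cardsC T; have := cardsD1 i (~: T); rewrite iT; lia.
    rewrite -sum_nat_const.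
    rewrite (eq_bigl (mem (~: T :\ i))) ?leq_sum // => j.
    by rewrite !inE andbC.
  by have := split_T b; rewrite sum_b -/sT; lia.
have := split_T (fun j => a j * b j); have := split_T a; rewrite sum_a.
have : rA * rB <= M * sT + rA * b i.
  rewrite (leq_trans (leq_mul (leqnn rA) rB_le)) //.
  by rewrite mulnDr leq_add2r leq_mul2r rAM orbT.
(* Adding [lb_T] and [lb_TC], the total mass [A * M + rA] of [a] multiplies [b i]; the part
   [A * M * b i] cancels, leaving [M * sT + rA * b i]. *)
nia.
Qed.

(** The map sending [x] to its residues modulo [m] and [n] reaches every compatible pair from a
    solution. *)
Lemma card_crt_solutions_ge (m n : nat) (SA : {set 'I_m}) (SB : {set 'I_n}) :
  0 < m -> 0 < n ->
  #|[set p in setX SA SB | p.1 == p.2 %[mod gcdn m n]]|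
    <= #|crt_solutions SA SB|.
Proof.
move=> m0 n0.
set L := (m * n) %/ gcdn m n.
have mL : m %| L by rewrite /L -muln_divA ?dvdn_gcdr // dvdn_mulr.
have nL : n %| L by rewrite /L -divn_mulAC ?dvdn_gcdl // dvdn_mull.
have L0 : 0 < L.
  rewrite divn_gt0 ?gcdn_gt0 ?m0 // dvdn_leq ?muln_gt0 ?m0 //.
  by rewrite dvdn_mulr ?dvdn_gcdl.
pose f (x : 'I_L) := (Ordinal (ltn_pmod x m0), Ordinal (ltn_pmod x n0)).
apply: leq_trans (leq_imset_card f _); apply/subset_leq_card/subsetP => -[a b].
rewrite !inE /= => /andP[/andP[aA bB] /eqP eq_ab].
have [x [xa xb]] := chinese_exists m n a b m0 n0 eq_ab.
(* Reduction modulo [L] keeps both residues, as [m] and [n] divide [L]. *)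
have ya : x %% L = a %[mod m] by rewrite modn_dvdm.
have yb : x %% L = b %[mod n] by rewrite modn_dvdm.
apply/imsetP; exists (Ordinal (ltn_pmod x L0)).
  rewrite inE; apply/existsP; exists a; rewrite aA.
  by apply/existsP; exists b; rewrite bB /= ya yb !eqxx.
by congr pair; apply: val_inj; rewrite /= ?ya ?yb modn_small.
Qed.

Theorem theorem2p1 (m n : nat) (SA : {set 'I_m}) (SB : {set 'I_n})
    (A rA B rB : nat) :
  0 < m -> 0 < n ->
  #|SA| = A * (m %/ gcdn m n) + rA -> rA < m %/ gcdn m n ->
  #|SB| = B * (n %/ gcdn m n) + rB -> rB < n %/ gcdn m n ->
  crt_bound m n A rA B rB <= #|crt_solutions SA SB|.
Proof.
move=> m0 n0 cardA ltA cardB ltB; rewrite /crt_bound.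
apply: leq_trans (card_crt_solutions_ge _ _ SA SB m0 n0).
set g := gcdn m n in cardA ltA cardB ltB *.
have g0 : 0 < g by rewrite gcdn_gt0 m0.
have gm : g %| m := dvdn_gcdl m n; have gn : g %| n := dvdn_gcdr m n.
have -> : (m * n) %/ g ^ 2 = (m %/ g) * (n %/ g).
  by rewrite -mulnn divnMA -muln_divA // -divn_mulAC.
pose res k (x : 'I_k) : 'I_g := Ordinal (ltn_pmod x g0).
have -> : [set p in setX SA SB | p.1 == p.2 %[mod g]] =
          [set p in setX SA SB | res _ p.1 == res _ p.2] by [].
rewrite card_fiber_product.
set a := fun c => #|[set x in SA | res m x == c]|.
set b := fun c => #|[set x in SB | res n x == c]|.
rewrite -[leqRHS]/(\sum_c a c * b c).
have aM c : a c <= m %/ g by apply: card_mod_class_le.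
have bN c : b c <= n %/ g by apply: card_mod_class_le.
have sum_a : \sum_c a c = A * (m %/ g) + rA.
  by rewrite -cardA (card_partition_fibers _ _ (res m)).
have sum_b : \sum_c b c = B * (n %/ g) + rB.
  by rewrite -cardB (card_partition_fibers _ _ (res n)).
have [//|ge_g] := ltnP (A + B) (g - 1).
case: eqP => [eq_g|ne_g].
  apply: (sum_mul_critical _ _ _ _ _ _ _ _ _ aM bN (ltnW ltA) sum_a sum_b).
  by rewrite card_ord eq_g subnK.
have := sum_mul_bounded _ _ _ _ _ aM bN; rewrite sum_a sum_b card_ord.
(* Here [A + B] exceeds [g - 1], so the difference [d] is exact. *)
have /subnK def_AB : g <= A + B by lia.
move: def_AB; move: (A + B - g) => d def_AB.
move: (m %/ g) (n %/ g) => M N.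
have : (d + g) * (M * N) = (A + B) * (M * N) by rewrite def_AB.
lia.
Qed.
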